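(* Let $G$ be a group, $T$ a type of algebras, and $(\theta,\mathcal A)\in\mathsf{pA}(G,\mathsf{Al}(T))$. The pair $(\boldsymbol\theta^{\mathbf U},\mathcal W(\mathcal A^U))$, where $\boldsymbol\theta^{\mathbf U}(x,[w]_\Theta)=[\overline{\theta^U}(x,w)]_\Theta$ for $x\in G$ and $w\in W(A^U)$, is an $\mathsf A(G,\mathsf{Al}(T))$-reflector of $(\theta,\mathcal A)$. The reflector morphism maps $a\in A$ to the $\Theta$-class $[1,a]_\Theta\in W(\mathcal A^U)$ of the one-letter word $[1,a]\in W(A^U)$.
   Context: Partial actions. A partial action of a group $G$ on a set $A$ is a partial map $\theta:G\times A\dashrightarrow A$ such that for all $x,y\in G$, $a\in A$: (i) $\theta(1,a)$ is defined and equals $a$; (ii) if $\theta(x,a)$ is defined, then $\theta(x^{-1},\theta(x,a))$ is defined and equals $a$; (iii) if $\theta(y,a)$ and $\theta(x,\theta(y,a))$ are defined, then $\theta(xy,a)$ is defined and equals $\theta(x,\theta(y,a))$. It is global if everywhere defined. One writes $xa$ for $\theta(x,a)$. The domain $D_x$ is $\{\theta(x,a)\mid a\in A,\ \theta(x,a)\text{ defined}\}$, and $\theta_x=\theta(x,-)$ is a bijection $D_{x^{-1}}\to D_x$. A type of algebras is a sequence $T=\{n_\gamma\}_{\gamma<o(T)}$ of non-negative integers indexed by ordinals; $\mathsf{Al}(T)$ is the category of (total) algebras of type $T$ with operations $f_\gamma$ of arity $n_\gamma$. A partial algebra of type $T$ is a set with partial operations $f_\gamma$ of arity $n_\gamma$.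 $\mathsf{pA}(G,\mathsf{Al}(T))$ is the category of pairs $(\theta,\mathcal A)$ with $\mathcal A\in\mathsf{Al}(T)$ and $\theta$ a partial action of $G$ on the set $A$ such that every $D_x$ is a subalgebra $\mathcal D_x$ of $\mathcal A$ and every $\theta_x:\mathcal D_{x^{-1}}\to\mathcal D_x$ is an isomorphism. Morphisms $(\theta,\mathcal A)\to(\theta',\mathcal A')$ are homomorphisms $\varphi$ such that whenever $\theta(x,a)$ is defined, $\theta'(x,\varphi(a))$ is defined and equals $\varphi(\theta(x,a))$. $\mathsf A(G,\mathsf{Al}(T))$ is the full subcategory of pairs with global $\theta$. The partial algebra $\mathcal A^U$. $A^U=(G\times A)/{\sim}$, where $(x,a)\sim(y,b)$ iff $(y^{-1}x)a$ is defined and equals $b$; $[x,a]$ is the class of $(x,a)$; $\theta^U$ is the global action $x[y,a]=[xy,a]$. $\mathcal A^U$ is the partial algebra on $A^U$ with $f_\gamma([x,a_1],\dots,[x,a_{n_\gamma}])=[x,f_\gamma(a_1,\dots,a_{n_\gamma})]$ for $x\in G$, $a_i\in A$, and $f_\gamma$ undefined on tuples not of this form (for $n_\gamma=0$, $f_\gamma=[1,f_\gamma]$); this is well defined. Words. For a set $X$, $\mathcal W(X)$ (with underlying set $W(X)$) is the free algebra of type $T$ over $X$: its elements (words) are the formal terms built from letters $x\in X$ and the operation symbols $f_\gamma$. Given a global action $\theta^U$ on $A^U$, $\overline{\theta^U}$ is the action of $G$ on $\mathcal W(A^U)$ which applies $\theta^U(x,-)$ to each letter of a word. The algebra $\mathcal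 W(\mathcal C)$ for a partial algebra $\mathcal C$ with underlying set $C$. The value $v(w)\in C$ of $w\in W(C)$ (possibly undefined) is obtained by evaluating: $v(c)=c$ for a letter $c$; $v(f_\gamma(w_1,\dots,w_{n_\gamma}))=(f_\gamma)_{\mathcal C}(v(w_1),\dots,v(w_{n_\gamma}))$ if all $v(w_i)$ and the right-hand side are defined, and is undefined otherwise. The congruence $\Theta$ on $\mathcal W(C)$ is defined recursively: $(w,w')\in\Theta$ iff either $v(w),v(w')$ are defined and equal, or $w=f_\gamma(w_1,\dots,w_{n_\gamma})$, $w'=f_\gamma(w_1',\dots,w_{n_\gamma}')$ with $(w_i,w_i')\in\Theta$ for all $i$. $[w]_\Theta$ is the class of $w$, and $\mathcal W(\mathcal C)=\mathcal W(C)/\Theta$, with underlying set $W(\mathcal C)$. Here this is applied to $\mathcal C=\mathcal A^U$. Reflector. For a subcategory $\mathsf D$ of $\mathsf C$, a $\mathsf D$-reflector of $C\in\mathsf C$ is $R\in\mathsf D$ with a morphism $\varepsilon:C\to R$ (the reflector morphism) such that for all $D\in\mathsf D$ and $\varphi:C\to D$ there is a unique $\psi:R\to D$ in $\mathsf D$ with $\psi\circ\varepsilon=\varphi$. Here $\mathsf C=\mathsf{pA}(G,\mathsf{Al}(T))$. *)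

(* Defs.v *)
From mathcomp Require Import all_boot.
From mathcomp Require Import boolp classical_sets.

Set Implicit Arguments.
Unset Strict Implicit.
Unset Printing Implicit Defensive.

Local Open Scope group_scope.
Local Open Scope quotient_scope.
Local Open Scope classical_set_scope.

(** Partial maps are [option]-valued functions; with classical axioms this is
    the same as single-valued relations. *)

Definition partial_action (G : groupType) (A : Type)
    (th : G -> A -> option A) : Prop :=
  [/\ forall a, th 1 a = Some a,
      forall x a b, th x a = Some b -> th x^-1 b = Some a &
      forall x y a b c,
        th y a = Some b -> th x b = Some c -> th (x * y) a = Some c].

Definition global_action (G : groupType) (A : Type)
    (th : G -> A -> option A) : Prop :=
  forall x a, exists b, th x a = Some b.

Definition dom (G : groupType) (A : Type) (th : G -> A -> option A) (x : G) :
    set A :=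
  [set b | exists a, th x a = Some b].

(* The ordinal-indexed sequence of arities is an arbitrary family: no use is
   made of the well-ordering of the operation symbols. *)
Record signature := Signature {
  symb : Type;
  arity : symb -> nat
}.

Record algebra (T : signature) := Algebra {
  acarrier :> Type;
  aop : forall g : symb T, ('I_(arity g) -> acarrier) -> acarrier
}.

Record palgebra (T : signature) := PAlgebra {
  pcarrier :> Type;
  pop : forall g : symb T, ('I_(arity g) -> pcarrier) -> option pcarrier
}.

Definition alg_hom (T : signature) (A B : algebra T) (h : A -> B) : Prop :=
  forall g (a : 'I_(arity g) -> A), h (aop a) = aop (fun i => h (a i)).

Definition subalgebra (T : signature) (A : algebra T) (S : set A) : Prop :=
  forall g (a : 'I_(arity g) -> A), (forall i, S (a i)) -> S (aop a).

(* [h], as a partial map, has domain [S] and is a bijective homomorphism from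
   [S] onto [S']; both are meant to be subalgebras of [A]. *)
Definition subalg_iso (T : signature) (A : algebra T) (S S' : set A)
    (h : A -> option A) : Prop :=
  [/\ forall a, S a <-> exists b, h a = Some b,
      forall b, S' b <-> exists a, h a = Some b,
      forall a a' b, h a = Some b -> h a' = Some b -> a = a' &
      forall g (a b : 'I_(arity g) -> A),
        (forall i, h (a i) = Some (b i)) -> h (aop a) = Some (aop b)].

Definition is_pA (G : groupType) (T : signature) (A : algebra T)
    (th : G -> A -> option A) : Prop :=
  [/\ partial_action th,
      forall x, subalgebra (dom th x) &
      forall x, subalg_iso (dom th x^-1) (dom th x) (th x)].

Record pA (G : groupType) (T : signature) := PA {
  pA_alg :> algebra T;
  pA_act : G -> pA_alg -> option pA_alg;
  pA_ax : is_pA pA_act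
}.

Definition pA_hom (G : groupType) (T : signature) (C D : pA G T)
    (phi : C -> D) : Prop :=
  alg_hom phi /\
  forall x a b, pA_act x a = Some b -> pA_act x (phi a) = Some (phi b).

Definition is_global (G : groupType) (T : signature) (C : pA G T) : Prop :=
  global_action (@pA_act G T C).

(* The subcategory is the full one on the objects satisfying [sub], so [psi]
   ranges over all morphisms of pA(G, Al(T)). *)
Definition is_reflector (G : groupType) (T : signature) (sub : pA G T -> Prop)
    (C R : pA G T) (eps : C -> R) : Prop :=
  [/\ sub R, pA_hom eps &
      forall D : pA G T, sub D -> forall phi : C -> D, pA_hom phi ->
        exists! psi : R -> D, pA_hom psi /\ psi \o eps = phi].

Section Globalization.
Variables (G : groupType) (T : signature) (C : pA G T).

Definition simU : rel {classic G * C} :=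
  fun p q => `[< pA_act (q.1^-1 * p.1) p.2 = Some q.2 >].

Lemma simU_refl : reflexive simU.
Proof.
move=> [x a]; apply/asboolP => /=.
by case: (pA_ax C) => -[h1 _ _] _ _; rewrite mulVg h1.
Qed.

Lemma simU_sym : symmetric simU.
Proof.
suff h p q : simU p q -> simU q p by move=> p q; apply/idP/idP; apply: h.
case: p q => [x a] [y b] /asboolP /= e; apply/asboolP => /=.
case: (pA_ax C) => -[_ h2 _] _ _.
by have := h2 _ _ _ e; rewrite invgM invgK.
Qed.

Lemma simU_trans : transitive simU.
Proof.
move=> [y b] [x a] [z c] /asboolP /= e1 /asboolP /= e2; apply/asboolP => /=.
case: (pA_ax C) => -[_ _ h3] _ _.
by have := h3 _ _ _ _ _ e1 e2; rewrite -mulgA mulVKg.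
Qed.

Canonical simU_equiv : equiv_rel {classic G * C} :=
  EquivRel simU simU_refl simU_sym simU_trans.

Definition AU : Type := {eq_quot simU_equiv}.

Definition classU (x : G) (a : C) : AU :=
  \pi_({eq_quot simU_equiv}) ((x, a) : {classic G * C}).

Lemma classUP x a y b :
  classU x a = classU y b <-> pA_act (y^-1 * x) a = Some b.
Proof.
split=> [/eqmodP /asboolP //|h].
by apply/eqmodP/asboolP.
Qed.

Lemma classU_ind (P : AU -> Prop) :
  (forall x a, P (classU x a)) -> forall q, P q.
Proof. by move=> h q; rewrite -[q]reprK; case: (repr q). Qed.

Definition actU (x : G) (q : AU) : AU :=
  classU (x * (repr q).1) (repr q).2.

Lemma actU_class x y a : actU x (classU y a) = classU (x * y) a.
Proof.
rewrite /actU; case e : (repr (classU y a)) => [z b] /=.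
have /classUP h : classU z b = classU y a by rewrite /classU -e reprK.
by apply/classUP; rewrite invgM -mulgA mulKg.
Qed.

(* [opU g u] is [[x, f_g a]] if [u] is of the form [i |-> [x, a i]], and is
   undefined otherwise; for nullary [g] this is [[1, f_g]], see
   [opU_nullary]. *)
Definition opU (g : symb T) (u : 'I_(arity g) -> AU) : option AU :=
  if pselect (exists p : G * ('I_(arity g) -> C),
                forall i, u i = classU p.1 (p.2 i)) is left h
  then Some (classU (projT1 (cid h)).1 (aop (projT1 (cid h)).2))
  else None.

Lemma opU_class g x (a : 'I_(arity g) -> C) :
  opU (fun i => classU x (a i)) = Some (classU x (aop a)).
Proof.
rewrite /opU; case: pselect => [h|[]]; last by exists (x, a).
case: (cid h) => -[y b] /= e; congr Some; apply/classUP.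
case: (pA_ax C) => _ _ /(_ (x^-1 * y)) [_ _ _]; apply=> i.
by apply/classUP; rewrite -e.
Qed.

Lemma opU_Some g (u : 'I_(arity g) -> AU) q :
  opU u = Some q ->
  exists x a, (forall i, u i = classU x (a i)) /\ q = classU x (aop a).
Proof.
rewrite /opU; case: pselect => // h; case: (cid h) => -[x a] /= e [<-].
by exists x, a.
Qed.

Lemma opU_nullary g (u : 'I_(arity g) -> AU) (a : 'I_(arity g) -> C) :
  arity g = 0 -> opU u = Some (classU 1 (aop a)).
Proof.
move=> g0; rewrite -opU_class; congr opU; apply/funext => i.
by have := ltn_ord i; rewrite [X in (_ < X)%N]g0.
Qed.

Definition algU : palgebra T := PAlgebra opU.

End Globalization.

Section Words.
Variable T : signature.

Inductive word (X : Type) : Type :=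
| Letter of X
| App (g : symb T) of ('I_(arity g) -> word X).

Fixpoint word_map (X Y : Type) (f : X -> Y) (w : word X) : word Y :=
  match w with
  | Letter c => Letter (f c)
  | App g u => App (fun i => word_map f (u i))
  end.

(* The family of all values of [o], when these are all defined. *)
Definition all_some (n : nat) (X : Type) (o : 'I_n -> option X) :
    option ('I_n -> X) :=
  if pselect (exists c, forall i, o i = Some (c i)) is left h
  then Some (projT1 (cid h)) else None.

Lemma all_someP n X (o : 'I_n -> option X) c :
  all_some o = Some c <-> forall i, o i = Some (c i).
Proof.
rewrite /all_some; case: pselect => [h|h]; last by split=> // e; case: h; exists c.
case: (cid h) => d /= e; split=> [[<-] //|e'].
by congr Some; apply/funext => i; move: (e' i); rewrite e => -[].
Qed.

Variable C : palgebra T.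

Fixpoint value (w : word C) : option C :=
  match w with
  | Letter c => Some c
  | App g u => obind (@pop T C g) (all_some (fun i => value (u i)))
  end.

Inductive Theta : word C -> word C -> Prop :=
| Theta_value w w' c : value w = Some c -> value w' = Some c -> Theta w w'
| Theta_App g (u u' : 'I_(arity g) -> word C) :
    (forall i, Theta (u i) (u' i)) -> Theta (App u) (App u').

Lemma Theta_refl w : Theta w w.
Proof.
by elim: w => [c|g u ih]; [apply: (@Theta_value _ _ c) | apply: Theta_App].
Qed.

Lemma Theta_sym w w' : Theta w w' -> Theta w' w.
Proof.
by elim=> [v v' c e e'|g u u' _ ih]; [apply: Theta_value e' e | apply: Theta_App].
Qed.

Lemma value_Theta w w' c : Theta w w' -> value w = Some c -> value w' = Some c.
Proof.
move=> h; elim: h c => [v v' c e e' d|g u u' _ ih c /=]; first by rewrite e e'.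
case e : (all_some _) => [d|] //= <-.
suff -> : all_some (fun i => value (u' i)) = Some d by [].
by apply/all_someP => i; apply: ih; move: i; apply/all_someP.
Qed.

Lemma Theta_trans w1 w2 w3 : Theta w1 w2 -> Theta w2 w3 -> Theta w1 w3.
Proof.
have inv v v' : Theta v v' ->
    (exists c, value v = Some c /\ value v' = Some c) \/
    match v with
    | Letter _ => False
    | App g u => exists2 u', v' = App u' & forall i, Theta (u i) (u' i)
    end.
  by case=> [x x' c ? ?|g u u' h]; [left; exists c | right; exists u'].
move=> h; elim: h w3 => [v v' c e e' w3 h|g u u' h ih w3 h3].
  by apply: Theta_value e _; apply: value_Theta h e'.
case: (inv _ _ h3) => [[c [e e']]|[u'' -> h']].
  apply: Theta_value e'; apply: value_Theta e.
  by apply: Theta_sym; apply: Theta_App.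
by apply: Theta_App => i; apply: ih.
Qed.

Definition theta_rel : rel {classic word C} := fun w w' => `[< Theta w w' >].

Lemma theta_rel_refl : reflexive theta_rel.
Proof. by move=> w; apply/asboolP; apply: Theta_refl. Qed.

Lemma theta_rel_sym : symmetric theta_rel.
Proof. by move=> w w'; apply/asboolP/asboolP; apply: Theta_sym. Qed.

Lemma theta_rel_trans : transitive theta_rel.
Proof.
by move=> w2 w1 w3 /asboolP h /asboolP h'; apply/asboolP; apply: Theta_trans h'.
Qed.

Canonical theta_equiv : equiv_rel {classic word C} :=
  EquivRel theta_rel theta_rel_refl theta_rel_sym theta_rel_trans.

Definition WC : Type := {eq_quot theta_equiv}.

Definition classT (w : word C) : WC :=
  \pi_({eq_quot theta_equiv}) (w : {classic word C}).

Definition reprT (q : WC) : word C := repr q.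

Lemma reprTK : cancel reprT classT.
Proof. exact: reprK. Qed.

Lemma classTP w w' : classT w = classT w' <-> Theta w w'.
Proof. by split=> [/eqmodP /asboolP //|h]; apply/eqmodP/asboolP. Qed.

Definition opW (g : symb T) (q : 'I_(arity g) -> WC) : WC :=
  classT (App (fun i => reprT (q i))).

Lemma opW_class g (u : 'I_(arity g) -> word C) :
  opW (fun i => classT (u i)) = classT (App u).
Proof.
by apply/classTP; apply: Theta_App => i; apply/classTP; rewrite reprTK.
Qed.

Definition algW : algebra T := Algebra opW.

End Words.

Arguments Letter {T X} _.
Arguments App {T X g} _.

Section Reflector.
Variables (G : groupType) (T : signature) (C : pA G T).

Definition word_actU (x : G) : word T (algU C) -> word T (algU C) :=
  word_map (@actU G T C x).

(* Given on a chosen representative; that the choice is irrelevant has to be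
   proved. *)
Definition actWU (x : G) (q : algW (algU C)) : algW (algU C) :=
  classT (word_actU x (reprT q)).

Definition epsWU (a : C) : algW (algU C) :=
  classT (Letter (classU 1 a) : word T (algU C)).

End Reflector.

(* Main.v *)
Require Import Defs.
From mathcomp Require Import all_boot.
From mathcomp Require Import boolp.

(** The reflector is a composite of two universal constructions.

    The first passes from [C] to the partial algebra [algU C] with its global
    action of [G].  A morphism [phi] from [C] to an object [D] with global action
    [act] extends to [algU C] by [[x, a] |-> act x (phi a)].  This is well defined
    because [phi] preserves the partial action.  It preserves every defined
    operation because such an operation takes place inside a single translate
    [[x, _]] of [C], where the map is [phi] followed by the endomorphism [act x]
    of [D] ([act_hom]).

    The second passes from a partial algebra [P] to the total algebra [algW P].
    A map [h] from [P] to a total algebra that preserves the defined operations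
    extends to words by evaluating them in the target.  Evaluation identifies
    [Theta]-equivalent words ([eval_Theta]): two words with the same value [c]
    are both evaluated to [h c], and [Theta] is otherwise generated by congruence.

    The action of [G] passes to [algW (algU C)] because each [actU x] preserves
    the defined operations of [algU C], so that [word_actU x] preserves values
    and hence [Theta] ([word_actU_Theta]).  Uniqueness of the extension holds
    because every word is built by the operations from letters [[x, a]], and
    [[x, a]] is the translate by [x] of [[1, a]], the image of [a]
    ([extW_unique]). *)

Set Implicit Arguments.
Unset Strict Implicit.
Unset Printing Implicit Defensive.

Local Open Scope group_scope.

(** * Homomorphisms out of the algebra of words over a partial algebra *)

Section Evaluation.
Variables (T : signature) (P : palgebra T) (B : algebra T) (h : P -> B).

Fixpoint eval (w : word T P) : B :=
  match w with
  | Letter c => h c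
  | App g u => aop (fun i => eval (u i))
  end.

Definition preserves_defined_ops : Prop :=
  forall g (u : 'I_(arity g) -> P) c,
    pop u = Some c -> h c = aop (fun i => h (u i)).

Hypothesis h_op : preserves_defined_ops.

(** A word with a value is evaluated through defined operations only, which [h]
    preserves. *)
Lemma eval_value w c : value w = Some c -> eval w = h c.
Proof.
elim: w c => [c' c [->] //|g u ih c /=].
case e : (all_some _) => [d|] //= /h_op ->.
congr (aop _); apply/funext => i; apply: ih.
by move: i; apply/all_someP.
Qed.

Lemma eval_Theta w w' : Theta w w' -> eval w = eval w'.
Proof.
elim=> [v v' c /eval_value -> /eval_value -> //|g u u' _ ih /=].
by congr (aop _); apply/funext.
Qed.

Definition evalW (q : algW P) : B := eval (reprT q).

Lemma evalW_class w : evalW (classT w) = eval w.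
Proof. by apply: eval_Theta; apply/classTP; rewrite reprTK. Qed.

Lemma evalW_hom : alg_hom evalW.
Proof. by move=> g q; rewrite [LHS]evalW_class. Qed.

End Evaluation.

(** * The action on the algebra of words *)

Lemma word_map_id (T : signature) (X : Type) (f : X -> X) (w : word T X) :
  f =1 id -> word_map f w = w.
Proof.
move=> fE; elim: w => [c|g u ih] /=; first by rewrite fE.
by congr App; apply/funext.
Qed.

Lemma word_map_comp (T : signature) (X Y Z : Type) (f : Y -> Z) (k : X -> Y)
    (w : word T X) :
  word_map f (word_map k w) = word_map (f \o k) w.
Proof. by elim: w => [c //|g u ih] /=; congr App; apply/funext. Qed.

Section Action.
Variables (G : groupType) (T : signature) (C : pA G T).

Lemma actU1 (q : AU C) : actU 1 q = q.
Proof. by elim/classU_ind: q => x a; rewrite actU_class mul1g. Qed.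

Lemma actUM x y (q : AU C) : actU x (actU y q) = actU (x * y) q.
Proof. by elim/classU_ind: q => z a; rewrite !actU_class mulgA. Qed.

(** A tuple in the translate [[y, _]] of [C] is moved to a tuple in the translate
    [[x * y, _]], so it stays in the domain of the operation. *)
Lemma actU_op x g (u : 'I_(arity g) -> AU C) c :
  opU u = Some c -> opU (fun i => actU x (u i)) = Some (actU x c).
Proof.
move=> /opU_Some[y [a [e ->]]]; rewrite actU_class -opU_class.
by congr opU; apply/funext => i; rewrite e actU_class.
Qed.

Lemma word_actU_value x (w : word T (algU C)) c :
  value w = Some c -> value (word_actU x w) = Some (actU x c).
Proof.
elim: w c => [c' c [->] //|g u ih c /=].
case e : (all_some _) => [d|] //= /(actU_op x) <-.
suff -> : all_some (fun i => value (word_actU x (u i))) =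
          Some (fun i => actU x (d i)) by [].
by apply/all_someP => i; apply: ih; move: i; apply/all_someP.
Qed.

(** Words with a common value [c] are sent to words with the common value
    [actU x c]; the rest of [Theta] is congruence, which the action respects
    because it changes only letters. *)
Lemma word_actU_Theta x (w w' : word T (algU C)) :
  Theta w w' -> Theta (word_actU x w) (word_actU x w').
Proof.
elim=> [v v' c e e'|g u u' _ ih]; last exact: Theta_App.
by apply: Theta_value; apply: word_actU_value; [exact: e | exact: e'].
Qed.

Lemma actWU_class x (w : word T (algU C)) :
  actWU x (classT w) = classT (word_actU x w).
Proof.
by apply/classTP/word_actU_Theta/classTP; rewrite reprTK.
Qed.

Lemma actWU1 (q : algW (algU C)) : actWU 1 q = q.
Proof.
by rewrite -[q]reprTK actWU_class /word_actU word_map_id //; exact: actU1.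
Qed.

Lemma actWUM x y (q : algW (algU C)) : actWU x (actWU y q) = actWU (x * y) q.
Proof.
rewrite -[q]reprTK !actWU_class /word_actU word_map_comp.
by congr (classT (word_map _ _)); apply/funext => p; exact: actUM.
Qed.

Lemma actWUK x : cancel (@actWU G T C x) (actWU x^-1).
Proof. by move=> q; rewrite actWUM mulVg actWU1. Qed.

Lemma actWUVK x : cancel (actWU x^-1) (@actWU G T C x).
Proof. by move=> q; rewrite actWUM mulgV actWU1. Qed.

Lemma actWU_hom x : alg_hom (@actWU G T C x).
Proof.
move=> g q /=; rewrite [LHS]actWU_class -opW_class.
by congr opW.
Qed.

Lemma actWU_is_pA :
  is_pA (fun (x : G) (q : algW (algU C)) => Some (actWU x q)).
Proof.
have domT x q : dom (fun x q => Some (@actWU G T C x q)) x q.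
  by exists (actWU x^-1 q); rewrite actWUVK.
split; first split.
- by move=> q; rewrite actWU1.
- by move=> x q _ [<-]; rewrite actWUK.
- by move=> x y q _ _ [<-] [<-]; rewrite actWUM.
- by move=> x g q _; exact: domT.
- move=> x; split.
  + by move=> q; split=> _; [exists (actWU x q) | exact: domT].
  + by [].
  + by move=> q q' _ [<-] [/(can_inj (actWUK x))].
  + move=> g q r e; rewrite actWU_hom; congr (Some (aop _)).
    by apply/funext => i; case: (e i).
Qed.

(** The operations of [algU C] are defined on tuples of the form [[1, a i]], so
    the one-step word on such a tuple has the same value as a single letter. *)
Lemma epsWU_hom : alg_hom (@epsWU G T C).
Proof.
move=> g a; rewrite [RHS]opW_class; apply/classTP.
apply: (@Theta_value T (algU C) _ _ (classU 1 (aop a))) => //=.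
have -> : all_some (fun i => Some (classU 1 (a i))) =
          Some (fun i => classU 1 (a i)) by apply/all_someP.
exact: opU_class.
Qed.

Lemma actWU_eps x (a : C) :
  actWU x (epsWU a) = classT (Letter (classU x a) : word T (algU C)).
Proof. by rewrite actWU_class /word_actU /= actU_class mulg1. Qed.

Lemma epsWU_act x (a b : C) :
  pA_act x a = Some b -> actWU x (epsWU a) = epsWU b.
Proof.
move=> e; rewrite actWU_eps; congr (classT (Letter _)).
by apply/classUP; rewrite invg1 mul1g.
Qed.

End Action.

(** * Extension of a morphism into an object with global action *)

Section Extension.
Variables (G : groupType) (T : signature) (C D : pA G T).
Variable act : G -> D -> D.
Hypothesis actE : forall x d, pA_act x d = Some (act x d).

Lemma actM x y d : act x (act y d) = act (x * y) d.
Proof.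
case: (pA_ax D) => -[_ _ h] _ _.
by have := h _ _ _ _ _ (actE y d) (actE x _); rewrite actE => -[].
Qed.

Lemma act1 d : act 1 d = d.
Proof. by case: (pA_ax D) => -[/(_ d)]; rewrite actE => -[]. Qed.

Lemma act_hom x : alg_hom (act x).
Proof.
move=> g d; case: (pA_ax D) => _ _ /(_ x)[_ _ _ h].
by have := h g d _ (fun i => actE x (d i)); rewrite actE => -[].
Qed.

Variable phi : C -> D.
Hypothesis phi_hom : pA_hom phi.

Definition extU (q : algU C) : D := act (repr q).1 (phi (repr q).2).

(** If [[x, a] = [y, b]] then [b] is the image of [a] under [y^-1 * x], hence so
    is [phi b] of [phi a], and both pairs give the same element of [D]. *)
Lemma extU_class x a : extU (classU x a) = act x (phi a).
Proof.
rewrite /extU; case e : (repr (classU x a)) => [y b] /=.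
have /classUP h : classU x a = classU y b by rewrite {2}/classU -e reprK.
have := phi_hom.2 _ _ _ h; rewrite actE => -[<-].
by rewrite actM mulVKg.
Qed.

Lemma extU_op : @preserves_defined_ops T (algU C) D extU.
Proof.
move=> g u c /opU_Some[x [a [e ->]]].
rewrite extU_class phi_hom.1 act_hom; congr (aop _).
by apply/funext => i; rewrite e extU_class.
Qed.

Lemma extU_act x q : extU (actU x q) = act x (extU q).
Proof. by elim/classU_ind: q => y a; rewrite actU_class !extU_class actM. Qed.

Definition extW : algW (algU C) -> D :=
  evalW extU.

Lemma extW_act x q : extW (actWU x q) = act x (extW q).
Proof.
rewrite -[q]reprTK actWU_class /extW !(evalW_class extU_op).
elim: (reprT q) => [c|g u ih] /=; first exact: extU_act.
by rewrite act_hom; congr (aop _); apply/funext.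
Qed.

Lemma extW_eps a : extW (epsWU a) = phi a.
Proof. by rewrite /extW (evalW_class extU_op) /= extU_class act1. Qed.

(** Words are built by the operations from letters [[x, a]], and such a letter is
    the translate by [x] of [epsWU a]; hence an equivariant homomorphism is
    determined by its composite with [epsWU]. *)
Lemma extW_unique (psi : algW (algU C) -> D) :
  alg_hom psi -> (forall x q, psi (actWU x q) = act x (psi q)) ->
  (forall a, psi (epsWU a) = phi a) ->
  psi =1 extW.
Proof.
move=> psi_hom psi_act psi_eps q.
rewrite -[q]reprTK /extW (evalW_class extU_op).
elim: (reprT q) => [c|g u ih] /=.
  elim/classU_ind: c => x a.
  by rewrite -actWU_eps psi_act psi_eps extU_class.
by rewrite -opW_class [LHS]psi_hom; congr (aop _); apply/funext.
Qed.

End Extension.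

Theorem mainTheorem5 (G : groupType) (T : signature) (C : pA G T) :
  (forall (x : G) (w : word T (algU C)),
      actWU x (classT w) = classT (word_actU x w)) /\
  exists WU_pA : is_pA (fun (x : G) (q : algW (algU C)) => Some (actWU x q)),
    is_reflector (@is_global G T) (R := PA WU_pA) (@epsWU G T C).
Proof.
split; first exact: actWU_class.
exists (@actWU_is_pA G T C); split.
- by move=> x q; exists (actWU x q).
- split; first exact: epsWU_hom.
  by move=> x a b /= /epsWU_act ->.
move=> D D_global phi phi_hom.
pose act x d := projT1 (cid (D_global x d)).
have actE x d : pA_act x d = Some (act x d) by exact: (projT2 (cid (D_global x d))).
exists (extW act phi); split.
  split; last by apply/funext => a; exact: extW_eps.
  split; first exact/evalW_hom/extU_op.
  by move=> x q _ [<-]; rewrite extW_act.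
move=> psi [[psi_hom psi_act] psi_eps]; apply/funext => q; apply/esym.
apply: extW_unique => //.
  move=> x {}q; have := psi_act x q _ erefl.
  by rewrite actE => -[->].
by move=> a; rewrite -psi_eps.
Qed.
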